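(* Assume $\bm\lambda\neq0$ and $\bm\mu\neq0$. Then $M_1(\bm\lambda,\bm\mu)$ is a cyclic (generated by $w$) but reducible $\widehat{\mathfrak{gl}}$-module, i.e. there is a nonzero proper subspace of $M_1(\bm\lambda,\bm\mu)$ invariant under all $E_{i,j}$.
   Context: Let $\widehat{\mathcal A}$ be the Weyl algebra: the unital associative complex algebra generated by $a(r),a^*(r)$ ($r\in\mathbb Z$) with relations $[a(r),a(s)]=[a^*(r),a^*(s)]=0$ and $[a(r),a^*(s)]=\delta_{r+s,0}$. Fix integers $n\ge 0$, $m\ge 1$, $\bm\lambda=(\lambda_0,\dots,\lambda_n)\in\mathbb C^{n+1}$, $\bm\mu=(\mu_1,\dots,\mu_m)\in\mathbb C^m$, and set $\lambda_i=0$ for $i>n$, $\mu_j=0$ for $j>m$. The Whittaker module $M_1(\bm\lambda,\bm\mu)=\widehat{\mathcal A}/\mathcal I$, where $\mathcal I$ is the left ideal generated by $a(i)-\lambda_i$ ($i\ge 0$) and $a^*(j)-\mu_j$ ($j\ge 1$); $w=w_{\bm\lambda,\bm\mu}$ denotes the image of $1$. Normal ordering: $:a(i)a^*(j):$ equals $a^*(j)a(i)$ if $i\ge 0$ and $j\le 0$, and equals $a(i)a^*(j)$ otherwise. For $i,j\in\mathbb Z$, $E_{i,j}:=\,:a(-i)a^*(j):$, an operator on $M_1(\bm\lambda,\bm\mu)$; these give $M_1(\bm\lambda,\bm\mu)$ the structure of a $\widehat{\mathfrak{gl}}$-module of central charge $-1$, and submodules/generation refer to invariance under all $E_{i,j}$.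 *)

(* Defs.v *)
From mathcomp Require Import all_boot all_algebra.
From mathcomp Require Import reals Rstruct.
From mathcomp Require Import complex.
From mathcomp.multinomials Require Import monalg.

Set Implicit Arguments.
Unset Strict Implicit.
Unset Printing Implicit Defensive.

Import GRing.Theory.
Local Open Scope ring_scope.

Definition CC : fieldType := (Rdefinitions.R)[i].

(* Generators: (false, r) stands for a(r), (true, r) for a^*(r). *)
Definition Gen := (bool * int)%type.

Definition FreeAlg := {malg CC[{fmonom Gen}]}.

Definition gen (g : Gen) : FreeAlg := << fmu g >>.
Definition a (r : int) : FreeAlg := gen (false, r).
Definition astar (r : int) : FreeAlg := gen (true, r).

(* lambda_i for i : int (lambda = (lambda_0,...,lambda_n), zero beyond n) *)
Definition lamf (n : nat) (lam : 'I_n.+1 -> CC) (i : int) : CC :=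
  if (0 <= i)%R then nth 0 [seq lam k | k <- enum 'I_n.+1] `|i|%N else 0.

(* mu_j for j : int (mu = (mu_1,...,mu_m), zero beyond m) *)
Definition muf (m : nat) (mu : 'I_m -> CC) (j : int) : CC :=
  if (1 <= j)%R then nth 0 [seq mu k | k <- enum 'I_m] (`|j|%N).-1 else 0.

(* The kernel of FreeAlg ->> M_1(lambda,mu) = Weyl / I :
   the two-sided ideal of the Weyl relations plus the left ideal generated by
   a(i) - lambda_i (i >= 0) and a^*(j) - mu_j (j >= 1).
   It is the smallest left ideal containing (relation) * y for all y and the
   Whittaker generators. *)
Inductive inK (n m : nat) (lam : 'I_n.+1 -> CC) (mu : 'I_m -> CC) :
    FreeAlg -> Prop :=
  | K0 : inK lam mu 0
  | KD x y : inK lam mu x -> inK lam mu y -> inK lam mu (x + y)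
  | KZ (c : CC) x : inK lam mu x -> inK lam mu (c *: x)
  | KL y x : inK lam mu x -> inK lam mu (y * x)
  | Kaa r s y : inK lam mu ((a r * a s - a s * a r) * y)
  | Kss r s y : inK lam mu ((astar r * astar s - astar s * astar r) * y)
  | Kas r s y :
      inK lam mu ((a r * astar s - astar s * a r - (r + s == 0)%:R) * y)
  | Klam (i : int) : (0 <= i)%R -> inK lam mu (a i - lamf lam i *: 1)
  | Kmu (j : int) : (1 <= j)%R -> inK lam mu (astar j - muf mu j *: 1).

(* E_{i,j} = :a(-i) a^*(j): *)
Definition E (i j : int) : FreeAlg :=
  if (0 <= - i)%R && (j <= 0)%R then astar j * a (- i) else a (- i) * astar j.

(* S, a subset of FreeAlg containing the kernel, represents a subspace of
   M_1(lambda,mu); it is a gl-hat submodule iff invariant under all E_{i,j}. *)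
Definition is_submodule (n m : nat) (lam : 'I_n.+1 -> CC) (mu : 'I_m -> CC)
    (S : FreeAlg -> Prop) : Prop :=
  [/\ (forall x, inK lam mu x -> S x),
      (forall x y, S x -> S y -> S (x + y)),
      (forall (c : CC) x, S x -> S (c *: x)) &
      (forall i j x, S x -> S (E i j * x))].

Definition generated_by_w n m (lam : 'I_n.+1 -> CC) (mu : 'I_m -> CC) : Prop :=
  forall S, is_submodule lam mu S -> S 1 -> forall x, S x.

Definition reducible n m (lam : 'I_n.+1 -> CC) (mu : 'I_m -> CC) : Prop :=
  exists S, [/\ is_submodule lam mu S,
                (exists x, S x /\ ~ inK lam mu x) &
                (exists x, ~ S x)].

(* Main.v *)
Require Import Defs.
From mathcomp Require Import all_boot all_algebra.
From mathcomp Require Import reals Rstruct complex.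
From mathcomp.multinomials Require Import monalg.
From mathcomp Require Import boolp finmap ring zify.
Import GRing.Theory.
Local Open Scope ring_scope.

(** Cyclicity.  If [mu_j <> 0], then on a word [x] of length [d] the operator
    [astar j] acts as [mu_j] up to words of length [< d], so
    [a r * x = mu_j^-1 (E (- r) j * x)] up to words of length [<= d]; hence
    all words are reached by induction on their length.  Symmetrically, [astar s]
    is recovered from an [a i] with [lambda_i <> 0].

    Reducibility.  The charge current acts on M_1(lambda, mu), realised as
    polynomials in the creation operators [X_k], by
    [J = sum_k c_k X_k - (charge)], where the [c_k] are the Whittaker eigenvalues.
    As each [E i j] preserves the charge, [J] commutes with it, so the image of
    [J] is a submodule.  It contains [J w = sum_k c_k X_k w <> 0], and it does
    not contain [w], because [J f] never has a constant term. *)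

(** Every element is a combination of words, and a word is built by adding letters on the left. *)
Lemma FreeAlg_ind (P : FreeAlg -> Prop) :
  P 0 -> P 1 ->
  (forall x y, P x -> P y -> P (x + y)) ->
  (forall (c : CC) x, P x -> P (c *: x)) ->
  (forall g x, P x -> P (gen g * x)) ->
  forall x, P x.
Proof.
move=> P0 P1 PD PZ PM x; rewrite [x]monalgE.
apply: (big_ind P) => // k _.
have -> : << x@_k *g k >> = x@_k *: << k >> :> FreeAlg.
  apply/malgP => l.
  by rewrite mcoeffZ (mcoeffU k x@_k) (mcoeffU k 1) mulrnAr mulr1.
apply: PZ; case: k => s; elim: s => [|g s IH].
  by rewrite -fmoneE.
have -> : << FMonom (g :: s) >> = gen g * << FMonom s >> :> FreeAlg.
  rewrite /gen malgM_def fgmulUU mulr1; congr (<< _ *g _ >>).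
  by apply/eqP; rewrite fmP -[_ (fmu g) _]/(fmmul _ _) fmmulE fmuE.
exact: PM.
Qed.

(** * Polynomial Fock space, the Weyl generators and the charge current *)

Section Fock.
Context {K : comNzRingType}.
Implicit Types (f : (int -> nat) -> int -> K) (k l : int).

(* The variable [X_k] is [a k] for [k < 0] and [astar (- k)] for [0 <= k].  A
   state is the family of its coefficients at an exponent [e] and a charge [d],
   in the divided-power basis, where [Pop k] is a derivative.  Exponents need not
   be finitely supported, so the charge is recorded separately. *)
Definition inc k (e : int -> nat) : int -> nat := fun j => (e j + (j == k))%N.
Definition dec k (e : int -> nat) : int -> nat := fun j => (e j - (j == k))%N.
Definition chg k : int := if k < 0 then 1 else -1.

Definition Xop k f : (int -> nat) -> int -> K :=
  fun e d => (e k)%:R * f (dec k e) (d - chg k).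
Definition Pop k f : (int -> nat) -> int -> K :=
  fun e d => f (inc k e) (d + chg k).

Lemma Xop_comm k l f e d : Xop k (Xop l f) e d = Xop l (Xop k f) e d.
Proof.
rewrite /Xop; have [->//|kl] := eqVneq k l.
have -> : dec k e l = e l by rewrite /dec eq_sym (negbTE kl) subn0.
have -> : dec l e k = e k by rewrite /dec (negbTE kl) subn0.
have -> : dec l (dec k e) = dec k (dec l e).
  by apply/funext => j; rewrite /dec subnAC.
by rewrite mulrCA addrAC.
Qed.

Lemma Pop_comm k l f e d : Pop k (Pop l f) e d = Pop l (Pop k f) e d.
Proof.
rewrite /Pop addrAC; congr (f _ _).
by apply/funext => j; rewrite /inc addnAC.
Qed.

Lemma Pop_Xop k l f e d :
  Pop k (Xop l f) e d = Xop l (Pop k f) e d + (k == l)%:R * f e d.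
Proof.
rewrite /Xop /Pop; have [->|kl] := eqVneq k l.
  have -> : dec l (inc l e) = e by apply/funext => j; rewrite /dec /inc addnK.
  rewrite addrK subrK /inc eqxx addn1 mul1r.
  (* At [e l = 0] the multiplication term vanishes, so the truncated subtraction in [dec] is
     harmless; otherwise [inc] undoes [dec]. *)
  case el: (e l) => [|p]; first by rewrite mul0r add0r mul1r.
  suff -> : (fun j => (dec l e j + (j == l))%N) = e.
    by rewrite [p.+2%:R]mulrSr mulrDl mul1r.
  apply/funext => j; rewrite /dec.
  have [->|] := eqVneq j l; last by rewrite subn0 addn0.
  by rewrite el; lia.
have -> : inc k e l = e l by rewrite /inc eq_sym (negbTE kl) addn0.
rewrite mul0r addr0 addrAC; congr (_ * f _ _).
apply/funext => j; rewrite /dec /inc.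
by have [->|_] := eqVneq j l; rewrite ?[l == k]eq_sym ?(negbTE kl) ?subn0 ?addn0.
Qed.

Definition lin (u : K) f (v : K) g : (int -> nat) -> int -> K :=
  fun e d => u * f e d + v * g e d.

Lemma Xop_lin k u f v g : Xop k (lin u f v g) = lin u (Xop k f) v (Xop k g).
Proof. by apply/funext => e; apply/funext => d; rewrite /Xop /lin; ring. Qed.

Lemma Pop_lin k u f v g : Pop k (lin u f v g) = lin u (Pop k f) v (Pop k g).
Proof. by []. Qed.

Variable c : int -> K.

(** The test [(k < 0) == x.1] singles out annihilation operators: [a k] is [c k] plus the derivative
    in [X_k = astar (- k)], while [astar (- k)] is [c k] minus the derivative in [X_k = a k], the
    sign coming from the order of the Weyl commutator. *)
Definition genop (x : Gen) f : (int -> nat) -> int -> K :=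
  let k := if x.1 then - x.2 else x.2 in
  if (k < 0) == x.1 then lin (c k) f (if x.1 then -1 else 1) (Pop k f)
  else Xop k f.

Lemma genop_lin x u f v g :
  genop x (lin u f v g) = lin u (genop x f) v (genop x g).
Proof.
rewrite /genop; case: ifP => _; last exact: Xop_lin.
by rewrite Pop_lin; apply/funext => e; apply/funext => d; rewrite /lin; ring.
Qed.

Lemma genop0 x : genop x (fun _ _ => 0) = fun _ _ => 0.
Proof.
apply/funext => e; apply/funext => d; rewrite /genop.
by case: ifP; rewrite /lin /Xop /Pop !mulr0 ?addr0.
Qed.

(** Letters of one kind attached to the same variable both multiply or both differentiate, so no
    commutator arises. *)
Lemma genop_comm b r s f :
  genop (b, r) (genop (b, s) f) = genop (b, s) (genop (b, r) f).
Proof.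
rewrite /genop /=; apply/funext => e; apply/funext => d.
set k := if b then - r else r; set l := if b then - s else s.
case: ifP => kb; case: ifP => lb.
- by rewrite !Pop_lin /lin Pop_comm; ring.
- rewrite Xop_lin /lin Pop_Xop.
  have /negbTE -> : k != l by apply: contraFneq lb => <-.
  by rewrite mul0r addr0.
- rewrite Xop_lin /lin Pop_Xop.
  have /negbTE -> : l != k by apply: contraFneq kb => <-.
  by rewrite mul0r addr0.
- exact: Xop_comm.
Qed.

(** The two letters share a variable exactly when [r = - s], and then one multiplies by it and the
    other differentiates. *)
Lemma genop_weyl r s f e d :
  genop (false, r) (genop (true, s) f) e d =
  genop (true, s) (genop (false, r) f) e d + (r + s == 0)%:R * f e d.
Proof.
have -> : (r + s == 0) = (r == - s) by rewrite addr_eq0.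
rewrite /genop /=; apply/esym; case: ifP => rn; case: ifP => sn.
- have /negbTE -> : r != - s.
    by apply: contraTneq sn => ->; rewrite (eqP rn).
  by rewrite !Pop_lin /lin Pop_comm mul0r; ring.
- by rewrite Xop_lin /lin Pop_Xop eq_sym; ring.
- by rewrite Xop_lin /lin Pop_Xop; ring.
- have /negbTE -> : r != - s.
    by apply: contraFneq sn => ->; move: rn; case: (_ < _).
  by rewrite mul0r addr0 Xop_comm.
Qed.

Variable I : seq int.
Hypotheses (uniqI : uniq I) (suppI : forall k, k \notin I -> c k = 0).

(** Since [c] vanishes off [I], the finite sum is the whole current. *)
Definition Jop f : (int -> nat) -> int -> K :=
  fun e d => \sum_(l <- I) c l * Xop l f e d - d%:~R * f e d.

Lemma Jop_lin u f v g : Jop (lin u f v g) = lin u (Jop f) v (Jop g).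
Proof.
apply/funext => e; apply/funext => d; rewrite /Jop.
under eq_bigr do rewrite Xop_lin /lin mulrDr (mulrCA (c _) u) (mulrCA (c _) v).
by rewrite big_split -!mulr_sumr /lin /=; ring.
Qed.

Lemma Jop_Xop k f :
  Jop (Xop k f) = lin 1 (Xop k (Jop f)) (- (chg k)%:~R) (Xop k f).
Proof.
apply/funext => e; apply/funext => d; rewrite /Jop /lin.
under eq_bigr do rewrite Xop_comm.
rewrite /Xop; under eq_bigr do rewrite mulrCA.
rewrite -mulr_sumr; move: (\sum_(i <- I) _) => S; rewrite intrB; ring.
Qed.

Lemma Jop_Pop k f :
  Jop (Pop k f) = lin 1 (lin 1 (Pop k (Jop f)) (chg k)%:~R (Pop k f)) (- c k) f.
Proof.
apply/funext => e; apply/funext => d; rewrite /Jop /lin.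
have H l : Xop l (Pop k f) e d = Pop k (Xop l f) e d - (k == l)%:R * f e d.
  by rewrite Pop_Xop addrK.
under eq_bigr do rewrite H mulrBr.
rewrite sumrB.
(* If [k] is not in [I], the sum is empty of contributions, in agreement with [c k = 0]. *)
have -> : \sum_(i <- I) c i * ((k == i)%:R * f e d) = c k * f e d.
  have [kI|kI] := boolP (k \in I).
    rewrite (bigD1_seq k) //= eqxx mul1r big1 ?addr0 // => i ik.
    by rewrite eq_sym (negbTE ik) mul0r mulr0.
  rewrite (suppI _ kI) mul0r big1_seq // => i /andP[_ iI].
  by case: eqP iI kI => [->->//|]; rewrite mul0r mulr0.
rewrite /Pop; move: (\sum_(i <- I) _) => S; rewrite intrD; ring.
Qed.

(** For annihilation operators, the term [- c k] from differentiating the linear part of [J] shifts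
    the constant [c k] by the same amount as the charge shifts the derivative. *)
Lemma Jop_genop x f :
  Jop (genop x f) = lin 1 (genop x (Jop f)) (if x.1 then 1 else -1) (genop x f).
Proof.
case: x => b r; rewrite /genop /=; move: (if b then - r else r) => k.
case: ifP => kb.
  rewrite Jop_lin Jop_Pop; apply/funext => e; apply/funext => d.
  rewrite /lin /chg; move/eqP: kb => ->.
  by case: b; rewrite ?mulrNz; ring.
rewrite Jop_Xop /chg; move: kb.
by case: b => /=; case: (_ < _) => //= _; rewrite ?mulrNz ?opprK.
Qed.

Definition vac : (int -> nat) -> int -> K :=
  fun e d => (`[< forall k, e k = 0%N >] && (d == 0))%:R.

Lemma Pop_vac k : Pop k vac = fun _ _ => 0.
Proof.
apply/funext => e; apply/funext => d; rewrite /Pop /vac.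
by case: asboolP => // /(_ k); rewrite /inc eqxx addn1.
Qed.

Lemma Jop_origin f : Jop f (fun _ => 0%N) 0 = 0.
Proof. by rewrite /Jop /Xop mul0r subr0 big1 // => i _; rewrite mul0r mulr0. Qed.

Lemma Jop_vac : Jop vac = fun e d => \sum_(l <- I) c l * Xop l vac e d.
Proof.
apply/funext => e; apply/funext => d; rewrite /Jop /vac.
by case: eqP => [->|_]; rewrite ?andbF ?mul0r ?mulr0 subr0.
Qed.

Lemma Jop_vac_neq0 k : c k != 0 -> Jop vac <> fun _ _ => 0.
Proof.
(* The coefficient of the monomial [X_k], at its charge, equals [c k]. *)
move=> ck0 /(congr1 (fun f => f (fun j => nat_of_bool (j == k)) (chg k))).
have kI : k \in I by apply: contraNT ck0 => /suppI ->.
rewrite Jop_vac (bigD1_seq k) //= big1 => [|i /negbTE ik]; last first.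
  by rewrite /Xop ik mul0r mulr0.
rewrite /Xop eqxx /vac subrr eqxx andbT asboolT => [|j]; last by rewrite /dec subnn.
by rewrite !mulr1 addr0; exact/eqP.
Qed.

End Fock.

(** * Vacuum representation: the map from [x] to [x w], coefficient by coefficient *)

Definition act (c : int -> CC) (x : FreeAlg) : (int -> nat) -> int -> CC :=
  fun e d => mmap idfun (fun s => foldr (genop c) vac (fmonom_val s) e d) x.

Lemma act0 c : act c 0 = fun _ _ => 0.
Proof. by apply/funext => e; apply/funext => d; rewrite /act raddf0. Qed.

Lemma actD c x y : act c (x + y) = lin 1 (act c x) 1 (act c y).
Proof.
by apply/funext => e; apply/funext => d; rewrite /act raddfD /lin !mul1r.
Qed.

Lemma actB c x y : act c (x - y) = lin 1 (act c x) (-1) (act c y).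
Proof.
by apply/funext => e; apply/funext => d; rewrite /act raddfB /lin mul1r mulN1r.
Qed.

Lemma actZ c u x : act c (u *: x) = fun e d => u * act c x e d.
Proof.
apply/funext => e; apply/funext => d.
rewrite /act (mmapEw (msuppZ_le _ _)) mmapE big_distrr /=.
by apply: eq_bigr => k _; rewrite mcoeffZ mulrA.
Qed.

Lemma act1 c : act c 1 = vac.
Proof.
apply/funext => e; apply/funext => d.
by rewrite /act -[1]/(<< fmone Gen >> : FreeAlg) mmapU mul1r fmoneE.
Qed.

Lemma actMgen c g x : act c (gen g * x) = genop c g (act c x).
Proof.
rewrite [x]monalgE; apply: (big_ind (fun y => act c (gen g * y) = _ (act c y))).
- by rewrite mulr0 act0 genop0.
- move=> y z Hy Hz.
  rewrite (mulrDr (gen g)) (actD c (gen g * y)) (actD c y) genop_lin.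
  exact: (f_equal2 (fun f h => lin 1 f 1 h) Hy Hz).
- move=> k _; rewrite /gen malgM_def fgmulUU mul1r.
  (* The null summand puts a scaled word in the form handled by [genop_lin]. *)
  have actU u (l : {fmonom Gen}) :
      act c << u *g l >> = lin u (foldr (genop c) vac (fmonom_val l)) 0 vac.
    apply/funext => e; apply/funext => d.
    by rewrite /act mmapU /lin mul0r addr0.
  rewrite !actU genop_lin -[_ (fmu g) _]/(fmmul _ _) fmmulE fmuE /=.
  by apply/funext => e; apply/funext => d; rewrite /lin !mul0r.
Qed.

Lemma act_nul_ideal c y x :
  act c x = (fun _ _ => 0) -> act c (y * x) = fun _ _ => 0.
Proof.
move=> x0; elim/FreeAlg_ind: y => [||y z Hy Hz|u y Hy|g y Hy].
- by rewrite mul0r act0.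
- by rewrite mul1r.
- rewrite (mulrDl y z x) (actD c (y * x)).
  (* Plain [rewrite Hy] first tries to unify distinct products of [FreeAlg],
     which takes a minute to fail. *)
  rewrite (f_equal2 (fun f h => lin 1 f 1 h) Hy Hz).
  by apply/funext => e; apply/funext => d; rewrite /lin !mulr0 addr0.
- rewrite -scalerAl actZ Hy.
  by apply/funext => e; apply/funext => d; rewrite mulr0.
- by rewrite -mulrA actMgen Hy genop0.
Qed.

Lemma act_genM2 c g h y :
  act c (gen g * gen h * y) = genop c g (genop c h (act c y)).
Proof. by rewrite -(mulrA (gen g)) (actMgen c g) (actMgen c h). Qed.

Lemma act_comm c b r s y :
  act c ((gen (b, r) * gen (b, s) - gen (b, s) * gen (b, r)) * y) =
  fun _ _ => 0.
Proof.
rewrite (mulrBl y (gen (b, r) * gen (b, s))).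
rewrite (actB c (gen (b, r) * gen (b, s) * y)).
rewrite (f_equal2 (fun f h => lin 1 f (-1) h)
  (act_genM2 c (b, r) (b, s) y) (act_genM2 c (b, s) (b, r) y)) genop_comm.
by apply/funext => e; apply/funext => d; rewrite /lin; ring.
Qed.

Lemma act_weyl c r s y :
  act c ((a r * astar s - astar s * a r - (r + s == 0)%:R) * y) =
  fun _ _ => 0.
Proof.
rewrite (mulrBl y (a r * astar s - astar s * a r)).
rewrite (mulrBl y (a r * astar s)) (mulr_natl y) -scaler_nat.
rewrite (actB c (a r * astar s * y - _)) (actZ c _ y).
rewrite (actB c (a r * astar s * y)).
rewrite (f_equal2 (fun f h => lin 1 f (-1) h)
  (act_genM2 c (false, r) (true, s) y) (act_genM2 c (true, s) (false, r) y)).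
by apply/funext => e; apply/funext => d; rewrite /lin genop_weyl; ring.
Qed.

(** * The Whittaker eigenvalues and reducibility *)

Section Whittaker.
Variables (n m : nat) (lam : 'I_n.+1 -> CC) (mu : 'I_m -> CC).

(** The eigenvalue on [w] of the annihilation operator paired with [X_k]. *)
Definition whit (k : int) : CC := if k < 0 then muf mu (- k) else lamf lam k.

Definition whit_supp : seq int :=
  [seq Posz i | i <- iota 0 n.+1] ++ [seq Negz j | j <- iota 0 m].

Lemma uniq_whit_supp : uniq whit_supp.
Proof.
rewrite cat_uniq !map_inj_uniq ?iota_uniq //=; try by move=> ? ? [].
by rewrite andbT; apply/hasPn => _ /mapP[j _ ->]; apply/mapP => -[].
Qed.

Lemma whit_out k : k \notin whit_supp -> whit k = 0.
Proof.
apply: contraNeq; rewrite mem_cat /whit; case: k => k nz; apply/orP.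
  left; apply: map_f; rewrite mem_iota add0n /=; apply: contraNT nz.
  rewrite -leqNgt => nk.
  by rewrite /lamf /= nth_default // size_map size_enum_ord.
right; apply: map_f; rewrite mem_iota add0n /=; apply: contraNT nz.
rewrite -leqNgt => mk.
by rewrite /muf /= nth_default // size_map size_enum_ord.
Qed.

(** The action thus descends to the Whittaker module, and a nonzero image certifies a nonzero vector
    there. *)
Lemma act_inK x : inK lam mu x -> act whit x = fun _ _ => 0.
Proof.
elim=> [|y z _ Hy _ Hz|u y _ Hy|y z _ Hz|r s y|r s y|r s y|i i0|j j1].
- exact: act0.
- rewrite actD (f_equal2 (fun f h => lin 1 f 1 h) Hy Hz).
  by apply/funext => e; apply/funext => d; rewrite /lin !mulr0 addr0.
- rewrite actZ (f_equal (fun f e d => u * f e d) Hy).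
  by apply/funext => e; apply/funext => d; rewrite mulr0.
- exact: act_nul_ideal.
- exact: act_comm.
- exact: act_comm.
- exact: act_weyl.
- have iF : (i < 0) = false by lia.
  rewrite actB actZ act1 -[a i]mulr1 (actMgen whit (false, i)) act1.
  rewrite /genop /= iF /= Pop_vac.
  apply/funext => e; apply/funext => d; rewrite /lin /whit iF; ring.
- have j0 : - j < 0 by lia.
  rewrite actB actZ act1 -[astar j]mulr1 (actMgen whit (true, j)) act1.
  rewrite /genop /= j0 /= Pop_vac.
  apply/funext => e; apply/funext => d; rewrite /lin /whit j0 opprK; ring.
Qed.

(** Each [E i j] contains one letter of each kind, in either order; their shifts of [J] by [1] and
    [-1] cancel. *)
Lemma act_E i j x : exists u,
  forall f, act whit x = Jop whit whit_supp f ->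
  act whit (E i j * x) = Jop whit whit_supp (u f).
Proof.
have H g h : g.1 != h.1 -> forall f, act whit x = Jop whit whit_supp f ->
    act whit (gen g * gen h * x) =
    Jop whit whit_supp (genop whit g (genop whit h f)).
  move=> gh f xf; rewrite act_genM2 xf.
  rewrite !(Jop_genop whit whit_supp uniq_whit_supp whit_out) !genop_lin.
  apply/funext => e; apply/funext => d; rewrite /lin.
  by case: g h gh => [[] r] [[] s] //= _; ring.
rewrite /E; case: ifP => _; eexists; exact: H.
Qed.

Lemma whittaker_reducible : (exists k, whit k != 0) -> reducible lam mu.
Proof.
case=> k0 ck0; pose J := Jop whit whit_supp.
(* Here [f] ranges over all states, even those with infinitely many nonzero coefficients; the
   constant term still excludes [w]. *)
exists (fun x => exists f, act whit x = J f); split.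
- split.
  + move=> x /act_inK ->; exists (lin 0 vac 0 vac); rewrite /J Jop_lin.
    by apply/funext => e; apply/funext => d; rewrite /lin !mul0r addr0.
  + move=> x y [f xf] [g yg]; exists (lin 1 f 1 g).
    by rewrite actD xf yg /J Jop_lin.
  + move=> u x [f xf]; exists (lin u f 0 vac); rewrite actZ xf /J Jop_lin.
    by apply/funext => e; apply/funext => d; rewrite /lin mul0r addr0.
  + by move=> i j x [f xf]; have [u Hu] := act_E i j x; exists (u f); exact: Hu.
(* This is [J w], with [X_l] spelled as a generator; the factor [1] fits [actMgen]. *)
- exists (\sum_(l <- whit_supp)
    whit l *: (gen (if l < 0 then (false, l) else (true, - l)) * 1)).
  set x := \sum_(l <- _) _.
  have xJ : act whit x = J vac.
    rewrite /J Jop_vac /x.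
    elim: whit_supp => [|l s IH].
      rewrite big_nil act0.
      by apply/funext => e; apply/funext => d; rewrite big_nil.
    rewrite big_cons actD IH actZ actMgen act1.
    apply/funext => e; apply/funext => d; rewrite big_cons /lin !mul1r.
    congr (_ * _ + _); rewrite /genop.
    by case l0: (l < 0) => /=; rewrite ?opprK l0.
  split; first by exists vac.
  move/act_inK; rewrite xJ.
  exact: (Jop_vac_neq0 whit whit_supp uniq_whit_supp whit_out k0 ck0).
- exists 1 => -[f /(congr1 (fun g => g (fun _ => 0%N) 0))].
  rewrite act1 /J Jop_origin /vac asboolT // eqxx => /eqP.
  by rewrite oner_eq0.
Qed.

End Whittaker.

Lemma malg_scalerAr (u : CC) (x y : FreeAlg) : u *: (x * y) = x * (u *: y).
Proof.
apply/malgP => k.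
rewrite (mcoeffMlw k (fsubset_refl (msupp x)) (msuppZ_le u y)).
rewrite (mcoeffZ u (x * y)) (mcoeffMl x y k) mulr_sumr.
apply: eq_bigr => i _; rewrite mulr_sumr; apply: eq_bigr => j _.
by rewrite mcoeffZ mulrnAr (mulrCA x@_i).
Qed.

(** * Generation by induction on word length *)

Section Filtration.
Context {F : fieldType} {A : lalgType F} {T : Type} (t : T -> A).
Implicit Types (x y : A) (u : F).

(* [fil d] is spanned by the words of length [< d]; in particular [fil 0] is zero. *)
Inductive fil : nat -> A -> Prop :=
  | fil0 d : fil d 0
  | filD d x y : fil d x -> fil d y -> fil d (x + y)
  | filZ d u x : fil d x -> fil d (u *: x)
  | fil1 d : fil d.+1 1
  | filM d g x : fil d x -> fil d.+1 (t g * x).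

Lemma fil_leq d k x : fil d x -> fil (k + d) x.
Proof.
have S e y : fil e y -> fil e.+1 y.
  by elim=> *; [exact: fil0|exact: filD|exact: filZ|exact: fil1|exact: filM].
by move=> xd; elim: k => // k; exact: S.
Qed.

Lemma fil_eq0 x : fil 0 x -> x = 0.
Proof.
move e0: 0%N => e xe.
elim: xe e0 => {x e} // [e x y _ Hx _ Hy|e u x _ Hx] e0.
  by rewrite Hx // Hy // addr0.
by rewrite Hx // scaler0.
Qed.

(** At [d = 0] the truncated predecessor does no harm, since [fil 0] is zero. *)
Lemma filM_pred d g x : fil d.-1 x -> fil d (t g * x).
Proof.
case: d => [/fil_eq0 ->|d]; last exact: filM.
by rewrite mulr0; exact: fil0.
Qed.

Hypothesis scalA : forall u x y, u *: (x * y) = x * (u *: y).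
Variable K : A -> Prop.
Hypotheses (K0 : K 0) (KD : forall x y, K x -> K y -> K (x + y)).
Hypothesis KZ : forall u x, K x -> K (u *: x).
Hypothesis KL : forall y x, K x -> K (y * x).
Hypothesis K_comm : forall g h, exists u, forall x,
  K (t h * (t g * x) - t g * (t h * x) - u *: x).

(* Commuting [t h] through a word to its right end, where it acts by [u], costs
   only words with one letter less. *)
Lemma eigen_fil h u d x : K (t h - u *: 1) -> fil d x ->
  exists2 y, fil d.-1 y & K (t h * x - u *: x - y).
Proof.
move=> Kh; elim=> {d x} [d|d x1 x2 _ [y1 y1d K1] _ [y2 y2d K2]|d v x _ [y yd Ky]
  |d|d g x xd [y yd Ky]].
- exists 0; first exact: fil0.
  by rewrite mulr0 scaler0 !subr0.
- exists (y1 + y2); first exact: filD.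
  rewrite mulrDr scalerDr 2!opprD [X in K X](AC (2*2*2) ((1*3*5)*(2*4*6))) /=.
  exact: KD.
- exists (v *: y); first exact: filZ.
  have := KZ v _ Ky.
  by rewrite -scalA !scalerBr !scalerA mulrC.
- exists 0; first exact: fil0.
  by rewrite mulr1 subr0.
(* Passing [t h] over [t g] leaves the commutator term [v *: x]; the old remainder is kept behind
   [t g]. *)
- have [v Kv] := K_comm g h; exists (t g * y + v *: x).
    by apply: filD; [exact: (filM_pred d)|exact: filZ].
  have := KD _ _ (KL (t g) _ Ky) (Kv x); congr K.
  rewrite 2!mulrBr -scalA opprD.
  rewrite [LHS](AC (3*3) ((1*5)*4*2*(3*6))) /= subrr add0r.
  by rewrite !addrA.
Qed.

Variable S : A -> Prop.
Hypotheses (KS : forall x, K x -> S x) (S1 : S 1).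
Hypothesis SD : forall x y, S x -> S y -> S (x + y).
Hypothesis SZ : forall u x, S x -> S (u *: x).
Hypothesis S_eigen : forall g, exists h u,
  [/\ u != 0, K (t h - u *: 1) & forall x, S x -> S (t g * (t h * x))].

Lemma fil_sub d x : fil d x -> S x.
Proof.
elim: d x => [|d IH] x; first by move=> /fil_eq0 ->; exact: KS.
move eqe: d.+1 => e xe.
elim: xe eqe => {x e} [e _|e x y _ Hx _ Hy ed|e u x _ Hx ed|//|e g x xe _ [ed]].
- exact: KS.
- by apply: SD; auto.
- by apply: SZ; auto.
move: xe; rewrite -ed => xd.
have [h [u [u0 Kh Sgh]]] := S_eigen g.
have [y yd Ky] := eigen_fil _ _ _ _ Kh xd.
(* The remainder [y] is shorter than [x], so restoring one letter stays within the induction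
   hypothesis. *)
have Sgy : S (t g * y) by apply: IH; exact: filM_pred.
suff : S (u *: (t g * x)) by move=> /(SZ u^-1); rewrite scalerK.
(* Subtracting from [t g * (t h * x)] both [t g * y] and [t g] times the error in [K] leaves
   [u *: (t g * x)]. *)
have := SD _ _ (SD _ _ (Sgh _ (IH _ xd)) (SZ (-1) _ Sgy))
  (SZ (-1) _ (KS _ (KL (t g) _ Ky))).
congr S; rewrite 2!mulrBr -scalA 2!scaleN1r 2!opprB.
by rewrite addrA subrK addrC subrK.
Qed.

End Filtration.

(** * Cyclicity of the Whittaker module and the final statement *)

Lemma fil_exists (x : FreeAlg) : exists d, fil gen d x.
Proof.
elim/FreeAlg_ind: x => [||x y [d xd] [k yk]|u x [d xd]|g x [d xd]].
- by exists 0%N; exact: fil0.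
- by exists 1%N; exact: fil1.
- exists (k + d)%N; apply: filD; first exact: fil_leq.
  by rewrite addnC; exact: fil_leq.
- by exists d; exact: filZ.
- by exists d.+1; exact: filM.
Qed.

Lemma mulr_commBl (A : pzRingType) (p q x : A) :
  (p * q - q * p) * x = p * (q * x) - q * (p * x).
Proof. by rewrite mulrBl -!mulrA. Qed.

Lemma inK_comm n m (lam : 'I_n.+1 -> CC) (mu : 'I_m -> CC) g h :
  exists u, forall x, inK lam mu
    (gen h * (gen g * x) - gen g * (gen h * x) - u *: x).
Proof.
have comm3 (p q r x : FreeAlg) : (p * q - q * p - r) * x =
    p * (q * x) - q * (p * x) - r * x.
  by rewrite (mulrBl x _ r) (mulr_commBl _ p q x).
have comm2 (p q x : FreeAlg) : (p * q - q * p) * x =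
    p * (q * x) - q * (p * x) - (0 : CC) *: x.
  by rewrite scale0r subr0 (mulr_commBl _ p q x).
have natmul k (x : FreeAlg) : k%:R * x = (k%:R : CC) *: x.
  by rewrite mulr_natl scaler_nat.
case: g h => [[] r] [[] s].
- by exists 0 => x; rewrite -comm2; exact: Kss.
- by exists (s + r == 0)%:R => x; rewrite -natmul -comm3; exact: Kas.
- exists (- (r + s == 0)%:R) => x; have := KZ (-1) (Kas lam mu r s x).
  rewrite comm3 natmul scaleN1r; congr inK.
  by rewrite (opprB (_ - _)) opprB scaleNr opprK addrC.
- by exists 0 => x; rewrite -comm2; exact: Kaa.
Qed.

Lemma whittaker_cyclic n m (lam : 'I_n.+1 -> CC) (mu : 'I_m -> CC) :
  (exists2 i : int, 0 <= i & lamf lam i != 0) ->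
  (exists2 j : int, 1 <= j & muf mu j != 0) ->
  generated_by_w lam mu.
Proof.
move=> [i i0 li] [j j1 mj] S [KS SD SZ SE] S1 x.
have [d xd] := fil_exists x; move: xd.
apply: (fil_sub gen malg_scalerAr (inK lam mu)) => //.
- exact: K0.
- exact: KD.
- exact: KZ.
- exact: KL.
- exact: inK_comm.
case=> [[] s].
- exists (false, i), (lamf lam i); split=> [//||y Sy]; first exact: Klam.
  have := SE (- i) s y Sy; rewrite /E opprK i0 /=; case: ifP => _.
    by rewrite -(mulrA (astar s)).
  rewrite -(mulrA (a i)) => Sai.
  (* For [s > 0] normal ordering puts [a i] first; reordering costs only a scalar multiple of
     [y]. *)
  have [u Ku] := inK_comm n m lam mu (false, i) (true, s).
  have := SD _ _ (SD _ _ (KS _ (Ku y)) (SZ u _ Sy)) Sai.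
  by rewrite subrK subrK.
- exists (true, j), (muf mu j); split=> [//||y Sy]; first exact: Kmu.
  (* As [j] is positive, normal ordering already leaves [a s] on the left. *)
  have jF : (j <= 0) = false by lia.
  have := SE (- s) j y Sy.
  by rewrite /E opprK jF andbF -(mulrA (a s)).
Qed.

Theorem theorem6p3 (n m : nat) (lam : 'I_n.+1 -> CC) (mu : 'I_m -> CC) :
  (1 <= m)%N ->
  (exists k, lam k != 0) ->
  (exists k, mu k != 0) ->
  generated_by_w lam mu /\ reducible lam mu.
Proof.
move=> _ [k lk] [l ml].
have lamE : lamf lam k = lam k.
  by rewrite /lamf /= (nth_map k) ?nth_ord_enum // size_enum_ord.
(* The ordinals indexing [mu] start at [0], the mathematical indices at [1]. *)
have muE : muf mu (l.+1 : int) = mu l.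
  by rewrite /muf /= (nth_map l) ?nth_ord_enum // size_enum_ord.
split; last by apply: whittaker_reducible; exists (k : int); rewrite /whit lamE.
by apply: whittaker_cyclic; [exists (k : int) | exists (l.+1 : int)];
  rewrite ?lamE ?muE.
Qed.
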